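(* Every two-dimensional real normed space that is not strictly convex has the Mazur-Ulam Property.
   Context: A normed space is strictly convex if its unit sphere contains no nondegenerate segment. A normed space $(X,\|\cdot\|_X)$ with unit sphere $S_X$ has the Mazur-Ulam Property if, for every normed space $(Y,\|\cdot\|_Y)$ with unit sphere $S_Y$, every surjective isometry (distance-preserving map) $\tau:S_X\to S_Y$ is the restriction of a linear isometry $\widetilde\tau:X\to Y$. *)

(* Defs.v *)
From HB Require Import structures.
From mathcomp Require Import all_boot all_order all_algebra.
From mathcomp Require Import all_classical all_reals all_analysis.

Set Implicit Arguments.
Unset Strict Implicit.
Unset Printing Implicit Defensive.

Import Order.TTheory GRing.Theory Num.Theory.
Import numFieldNormedType.Exports.

Local Open Scope classical_set_scope.
Local Open Scope ring_scope.

Definition has_dimension (R : realType) (X : lmodType R) (n : nat) : Prop :=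
  exists e : 'I_n -> X,
    (forall x : X, exists a : 'I_n -> R, x = \sum_(i < n) a i *: e i) /\
    (forall a : 'I_n -> R, \sum_(i < n) a i *: e i = 0 -> forall i, a i = 0).

Definition unit_sphere (R : realType) (X : normedModType R) : set X :=
  [set x | `|x| = 1].
Arguments unit_sphere {R} X.

Definition segment (R : realType) (X : normedModType R) (x y : X) : set X :=
  [set (1 - t) *: x + t *: y | t in `[0, 1]%classic].

Definition strictly_convex (R : realType) (X : normedModType R) : Prop :=
  forall x y : X, x <> y -> ~ (segment x y `<=` unit_sphere X).

Definition isometry_on (R : realType) (X Y : normedModType R)
    (A : set X) (f : X -> Y) : Prop :=
  forall x y : X, A x -> A y -> `|f x - f y| = `|x - y|.

(* A map between the unit spheres is represented by a map [tau : X -> Y] whose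
   values off the unit sphere of [X] are irrelevant. *)
Definition mazur_ulam_property (R : realType) (X : normedModType R) : Prop :=
  forall (Y : normedModType R) (tau : X -> Y),
    set_fun (unit_sphere X) (unit_sphere Y) tau ->
    set_surj (unit_sphere X) (unit_sphere Y) tau ->
    isometry_on (unit_sphere X) tau ->
    exists T : {linear X -> Y},
      isometry_on setT T /\ forall x : X, unit_sphere X x -> T x = tau x.

(* Main.v *)
(* Let [-1,1] -> S_X, t |-> u + t v parametrize a maximal segment F of S_X. For
   x in the interior of F the points of S_X at distance 2 from x form -F.
   Transported by tau, this forces tau(F) and tau(-F) to be opposite segments
   t |-> a + t b, again maximal. Restrict the inverse of tau to the sphere of
   span(a, b): in the coordinates (u, v) and (a, b) it becomes a
   distance-preserving map s between the spheres of two norms N1, N2 on R^2,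
   identical on F = {1} x [-1,1] and, up to a flip, on -F. It need not be onto
   a priori, and Y need not be assumed to be two-dimensional.
   The distances to the four end points exclude the flip and show that s
   preserves the upper arc. If w is fixed by s and p = w + c (1,1) with c >= 0,
   then N2(s p - w) = c places s p to the left of p, or below it; when s p is
   itself of the form w' + c' (1,1) with w' fixed, the converse holds as well,
   and s p = p. So the fixed set propagates along chords parallel to (1,1) and,
   by symmetry, to (-1,1). Were the upper arc not entirely fixed, let q0, q1 be
   the ends of the two maximal fixed arcs issuing from -F and F; the chord
   q0 q1 is not parallel to both directions, hence one of the two arcs can be
   prolonged. So s is the identity, N1 = N2, and tau is linear. *)
Require Import Defs.
From HB Require Import structures.
From mathcomp Require Import all_boot all_order all_algebra.
From mathcomp Require Import all_classical all_reals all_analysis.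
From mathcomp Require Import ring lra.

Set Implicit Arguments.
Unset Strict Implicit.
Unset Printing Implicit Defensive.

Import Order.TTheory GRing.Theory Num.Theory.
Import numFieldNormedType.Exports.

Local Open Scope classical_set_scope.
Local Open Scope ring_scope.

(* The norm of a plane in coordinates for which {1} x [-1,1] is a maximal
   segment of the unit sphere. *)
Record face_norm (R : realType) (N : R -> R -> R) : Prop := FaceNorm {
  fnZ : forall c x y, N (c * x) (c * y) = `|c| * N x y;
  fnD : forall x y x' y', N (x + x') (y + y') <= N x y + N x' y';
  fn_ge : forall x y, `|x| <= N x y;
  fn_face : forall x y, N x y = `|x| <-> `|y| <= `|x| }.

(** [(sx, sy)] stands for the inverse of the sphere isometry in coordinates; it is constrained only
    on the unit sphere of [N1], and [eps] records a possible flip of the opposite face. *)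
Record face_embedding (R : realType) (N1 N2 sx sy : R -> R -> R) (eps : R) :
    Prop := FaceEmbedding {
  fe_unit : forall x y, N1 x y = 1 -> N2 (sx x y) (sy x y) = 1;
  fe_dist : forall x y x' y', N1 x y = 1 -> N1 x' y' = 1 ->
    N2 (sx x y - sx x' y') (sy x y - sy x' y') = N1 (x - x') (y - y');
  fe_front : forall t, `|t| <= 1 -> sx 1 t = 1 /\ sy 1 t = t;
  fe_back : forall t, `|t| <= 1 -> sx (- 1) t = - 1 /\ sy (- 1) t = eps * t;
  fe_sign : eps = 1 \/ eps = - 1 }.

(** * Planar norms with a vertical face *)

Section FaceNorm.
Context (R : realType) (N : R -> R -> R) (fN : face_norm N).

Lemma fn_opp x y : N (- x) (- y) = N x y.
Proof. by have := fnZ fN (-1) x y; rewrite !mulN1r normrN normr1 mul1r. Qed.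

Lemma fn_x0 x : N x 0 = `|x|.
Proof. by apply/(fn_face fN); rewrite normr0. Qed.

Lemma fn_ge0 x y : 0 <= N x y.
Proof. exact: le_trans (fn_ge fN x y). Qed.

Lemma fn_0y_gt0 y : y != 0 -> 0 < N 0 y.
Proof.
move=> y0; rewrite lt_neqAle fn_ge0 andbT; apply/eqP => /esym N0.
have : `|y| <= `|0 : R| by apply/(fn_face fN); rewrite N0 normr0.
by rewrite normr0 normr_le0; apply/negP.
Qed.

Lemma fn_unit_le1 x y : N x y = 1 -> `|x| <= 1.
Proof. by move=> <-; apply: fn_ge. Qed.

(** Along a vertical line the norm is convex; it is [|x|] at height 0 and, by [fn_face], more than
    that at height [z]. *)
Lemma fn_lt x y z : 0 <= y -> y < z -> `|x| < z -> N x y < N x z.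
Proof.
move=> y0 yz xz; have z0 : 0 < z by lra.
have Nz : `|x| < N x z.
  rewrite lt_neqAle fn_ge // andbT; apply/eqP => /esym /(fn_face fN).
  by rewrite (gtr0_norm z0); lra.
have t1 : y / z < 1 by rewrite ltr_pdivrMr //; lra.
have t0 : 0 <= y / z by rewrite divr_ge0 // ltW.
have := fnD fN ((1 - y / z) * x) ((1 - y / z) * 0) (y / z * x) (y / z * z).
rewrite !(fnZ fN) fn_x0.
have -> : (1 - y / z) * x + y / z * x = x by ring.
have -> : (1 - y / z) * 0 + y / z * z = y by field; lra.
have t2 : 0 <= 1 - y / z by lra.
rewrite (ger0_norm t0) (ger0_norm t2) => H.
apply: (le_lt_trans H); have : 0 < (1 - y / z) * (N x z - `|x|).
  by apply: mulr_gt0; lra.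
lra.
Qed.

Lemma fn_lt_opp x y z : y <= 0 -> z < y -> `|x| < - z -> N x y < N x z.
Proof.
move=> y0 zy xz; rewrite -fn_opp -(fn_opp x z).
by apply: fn_lt; rewrite ?normrN //; lra.
Qed.

Lemma fn_x1 x : `|x| <= 1 -> N x 1 <= 1.
Proof.
move=> /ler_normlP [x1 x2].
have := fnD fN ((1 + x) / 2 * 1) ((1 + x) / 2 * 1)
  ((1 - x) / 2 * (- 1)) ((1 - x) / 2 * 1).
have -> : (1 + x) / 2 * 1 + (1 - x) / 2 * (- 1) = x by field.
have -> : (1 + x) / 2 * 1 + (1 - x) / 2 * 1 = 1 by field.
rewrite !(fnZ fN).
have -> : N 1 1 = 1 by rewrite -{3}(normr1 R); apply/(fn_face fN).
have -> : N (-1) 1 = 1.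
  by rewrite -{3}(normr1 R) -(normrN 1); apply/(fn_face fN); rewrite normrN.
by rewrite !ger0_norm; lra.
Qed.

Lemma fn_xN1 x : `|x| <= 1 -> N x (-1) <= 1.
Proof. by move=> x1; rewrite -fn_opp opprK; apply: fn_x1; rewrite normrN. Qed.

Lemma fn_unit_ge1 x y : N x y = 1 -> `|x| < 1 -> 1 <= `|y|.
Proof.
move=> Nxy x1; rewrite leNgt; apply/negP => /ltr_normlP [y1 y2].
have [y0|y0] := leP 0 y.
  have := fn_lt y0 y2 x1; have := fn_x1 (ltW x1); lra.
have yN : -1 < y by lra.
have := fn_lt_opp (ltW y0) yN; rewrite opprK => /(_ x x1).
have := fn_xN1 (ltW x1); lra.
Qed.

Lemma fn_le_coord x y : N x y <= `|x| + `|y| * N 0 1.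
Proof.
have := fnD fN x 0 (y * 0) (y * 1).
by rewrite (fnZ fN) fn_x0 mulr0 mulr1 addr0 add0r.
Qed.

Lemma fn_y_le x y : `|y| * N 0 1 <= 2 * N x y.
Proof.
have := fnD fN x y (- x) 0; rewrite fn_x0 subrr addr0 normrN.
have := fnZ fN y 0 1; rewrite mulr0 mulr1 => ->.
have := fn_ge fN x y; lra.
Qed.

End FaceNorm.

Lemma fn_equiv (R : realType) (N1 N2 : R -> R -> R) x y :
  face_norm N1 -> face_norm N2 ->
  N2 x y <= (1 + 2 * (N2 0 1 / N1 0 1)) * N1 x y.
Proof.
move=> fN1 fN2.
have p1 : 0 < N1 0 1 by apply: (fn_0y_gt0 fN1); rewrite oner_neq0.
have p2 := fn_ge0 fN2 0 1.
apply: (le_trans (fn_le_coord fN2 x y)); rewrite mulrDl mul1r.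
apply: lerD; first exact: fn_ge.
have := fn_y_le fN1 x y; rewrite -ler_pdivlMr // => H.
apply: (le_trans (ler_wpM2r p2 H)).
by rewrite le_eqVlt; apply/orP; left; apply/eqP; field; lra.
Qed.

(** * Images of points of the upper arc *)

Section FaceEmbedding.
Context (R : realType) (N1 N2 sx sy : R -> R -> R) (eps : R).
Context (fN1 : face_norm N1) (fN2 : face_norm N2).
Context (emb : face_embedding N1 N2 sx sy eps).

(** An upper point is strictly nearer to [(1, 1)] than to [(1, -1)], and likewise on the opposite
    face. Distances being preserved, its image cannot lie below, and the opposite face cannot be
    flipped. *)
Lemma fe_upper x y : N1 x y = 1 -> `|x| < 1 -> 0 < y ->
  [/\ `|sx x y| < 1, 1 <= sy x y & eps = 1].
Proof.
move=> Np x1 y0.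
have y1 : 1 <= y by have := fn_unit_ge1 fN1 Np x1; rewrite gtr0_norm.
have [xl xr] := ltr_normlP _ _ x1.
have Ns := fe_unit emb Np.
have n11 : `|1 : R| <= 1 by rewrite normr1.
have nN11 : `|-1 : R| <= 1 by rewrite normrN normr1.
have Nface a t : `|a| = 1 -> `|t| <= 1 -> N1 a t = 1.
  by move=> a1 t1; rewrite -a1; apply/(fn_face fN1); rewrite a1.
have n1 : `|1 : R| = 1 by rewrite normr1.
have nN1 : `|-1 : R| = 1 by rewrite normrN normr1.
have front t (t1 : `|t| <= 1) : N2 (sx x y - 1) (sy x y - t) = N1 (x - 1) (y - t).
  have [fx fy] := fe_front emb t1.
  by have := fe_dist emb Np (Nface _ _ n1 t1); rewrite fx fy.
have back t (t1 : `|t| <= 1) :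
    N2 (sx x y + 1) (sy x y - eps * t) = N1 (x + 1) (y - t).
  have [fx fy] := fe_back emb t1.
  have := fe_dist emb Np (Nface _ _ nN1 t1).
  by rewrite fx fy !opprK.
(* An image on a face would also be the image of a point of a face; that point would be at distance
   0 from [(x, y)], so [|x| = 1]. *)
have sx1 : `|sx x y| < 1.
  have eps2 : eps * eps = 1 by case: (fe_sign emb) => ->; ring.
  have epsn : `|eps| = 1 by case: (fe_sign emb) => ->.
  rewrite lt_neqAle (fn_unit_le1 fN2 Ns) andbT; apply/negP => /eqP sx1.
  have sy1 : `|sy x y| <= 1.
    by rewrite -sx1; apply/(fn_face fN2); rewrite Ns sx1.
  have [s1|s1] : sx x y = 1 \/ sx x y = -1.
    by move/eqP: sx1; rewrite eqr_norml ler01 andbT => /orP[]/eqP; tauto.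
  - have := front _ sy1; rewrite s1 !subrr fn_x0 // normr0.
    have := fn_ge fN1 (x - 1) (y - sy x y) => H H1; rewrite -H1 in H.
    by move: H; rewrite normr_le0 => /eqP; lra.
  - have esy : `|eps * sy x y| <= 1 by rewrite normrM epsn mul1r.
    have := back _ esy; rewrite s1 mulrA eps2 mul1r subrr addNr fn_x0 // normr0.
    have := fn_ge fN1 (x + 1) (y - eps * sy x y) => H H1; rewrite -H1 in H.
    by move: H; rewrite normr_le0 => /eqP; lra.
have [sl sr] := ltr_normlP _ _ sx1.
have xm : `|x - 1| < y + 1 by rewrite ltr_norml; lra.
have xp : `|x + 1| < y + 1 by rewrite ltr_norml; lra.
have ym : 0 <= y - 1 by lra.
have yy : y - 1 < y + 1 by lra.
have Lm := fn_lt fN1 ym yy xm; have Lp := fn_lt fN1 ym yy xp.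
have Nopp a b : N1 a (b + 1) = N1 a (b - -1) by rewrite opprK.
have sy1 : 1 <= sy x y.
  have : 1 <= `|sy x y| by apply: (fn_unit_ge1 fN2 Ns).
  rewrite ler_normr => /orP[//|syN].
  have a1 : sy x y + 1 <= 0 by lra.
  have a2 : sy x y - 1 < sy x y + 1 by lra.
  have a3 : `|sx x y - 1| < - (sy x y - 1) by rewrite ltr_norml; lra.
  have := fn_lt_opp fN2 a1 a2 a3.
  move: Lm; rewrite Nopp -!front // opprK; lra.
split => //; case: (fe_sign emb) => // eN.
have a1 : 0 <= sy x y - 1 by lra.
have a2 : sy x y - 1 < sy x y + 1 by lra.
have a3 : `|sx x y + 1| < sy x y + 1 by rewrite ltr_norml; lra.
have := fn_lt fN2 a1 a2 a3.
by move: Lp; rewrite Nopp -!back // eN !mulN1r !opprK; lra.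
Qed.

End FaceEmbedding.

(** * Radial parametrization of the upper arc *)

Section UpperArc.
Context (R : realType) (N : R -> R -> R) (fN : face_norm N).

Lemma fn_radial_gt0 k : 0 < N k 1.
Proof.
have [->|k0] := eqVneq k 0; first by rewrite (fn_0y_gt0 fN) // oner_neq0.
by apply: lt_le_trans (fn_ge fN k 1); rewrite normr_gt0.
Qed.

Lemma fn_radial_ge k : N 0 1 / 2 <= N k 1.
Proof. by have := fn_y_le fN k 1; rewrite normr1 mul1r; lra. Qed.

Lemma fn_radial_lip k l : `|N k 1 - N l 1| <= `|k - l|.
Proof.
have le a b : N a 1 - N b 1 <= `|a - b|.
  have := fnD fN (a - b) 0 b 1; rewrite fn_x0 // subrK add0r; lra.
by rewrite ler_norml (le k l) andbT; have := le l k; rewrite distrC; lra.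
Qed.

Lemma fn_arc_unit k : N (k / N k 1) (1 / N k 1) = 1.
Proof.
have n0 := fn_radial_gt0 k.
rewrite ![_ / N k 1]mulrC (fnZ fN) ger0_norm ?invr_ge0 ?ltW // mulVf //; lra.
Qed.

(** The difference of the two points is a horizontal vector of length [c * |k - l|] plus [d] times a
    unit vector; both terms have norm at most [2 / N 0 1 * |k - l|]. *)
Lemma fn_arc_lip k l :
  N (k / N k 1 - l / N l 1) (1 / N k 1 - 1 / N l 1)
    <= 4 / N 0 1 * `|k - l|.
Proof.
have nk := fn_radial_gt0 k; have nl := fn_radial_gt0 l.
have n0 := fn_radial_gt0 0.
set c := (N k 1)^-1; set d := (N l 1 - N k 1) * c.
have -> : k / N k 1 - l / N l 1 = c * (k - l) + d * (l / N l 1).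
  by rewrite /d /c; field; lra.
have -> : 1 / N k 1 - 1 / N l 1 = c * 0 + d * (1 / N l 1).
  by rewrite /d /c; field; lra.
apply: (le_trans (fnD fN _ _ _ _)).
rewrite !(fnZ fN) fn_arc_unit mulr1 fn_x0 // /d normrM.
have c0 : 0 <= c by rewrite invr_ge0 ltW.
rewrite (ger0_norm c0).
have c1 : c <= 2 / N 0 1.
  rewrite /c -[2 / _]invrK lef_pV2 ?posrE ?invr_gt0 ?divr_gt0 //.
  by rewrite invf_div fn_radial_ge.
have := fn_radial_lip l k; rewrite (distrC l k) => H.
have := ler_wpM2r c0 H; have := ler_wpM2l (normr_ge0 (k - l)) c1; lra.
Qed.

Lemma fn_radial_continuous : continuous (N ^~ 1).
Proof.
move=> k; apply/cvgrPdist_lt => e e0; near=> l.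
by apply: (le_lt_trans (fn_radial_lip k l)); near: l; apply: (nbhsx_ballx k _ e0).
Unshelve. all: end_near. Qed.

End UpperArc.

(* The upper arc of the sphere is parametrized radially by k in [-1,1], that is
   by the points (k, 1) / N(k, 1), from (-1,1) to (1,1). *)
Definition arc_fixed (R : realType) (N sx sy : R -> R -> R) (k : R) :=
  sx (k / N k 1) (1 / N k 1) = k / N k 1 /\
  sy (k / N k 1) (1 / N k 1) = 1 / N k 1.

Lemma fn_face1 (R : realType) (N : R -> R -> R) t :
  face_norm N -> `|t| <= 1 -> N 1 t = 1.
Proof. by move=> fN t1; rewrite -{2}(normr1 R); apply/(fn_face fN); rewrite normr1. Qed.

Lemma fn_faceN1 (R : realType) (N : R -> R -> R) t :
  face_norm N -> `|t| <= 1 -> N (-1) t = 1.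
Proof.
by move=> fN t1; rewrite -(fn_opp fN) opprK (fn_face1 fN) // normrN.
Qed.

(** * Propagation of fixed points along the direction [(1, 1)] *)

Section Extension.
Context (R : realType) (N1 N2 sx sy : R -> R -> R).
Context (fN1 : face_norm N1) (fN2 : face_norm N2).
Context (emb : face_embedding N1 N2 sx sy 1).

(** Ordinate minus abscissa is constant along [(1, 1)]. It runs through [[0, 2]] on the face at -1,
    then varies continuously along the fixed arc, so the value [y - x] is attained at a fixed
    point. *)
Lemma arc_reach k0 x y : -1 <= k0 <= 1 ->
  (forall k, -1 <= k <= k0 -> arc_fixed N1 sx sy k) ->
  `|x| <= 1 -> 1 <= y -> k0 * y < x -> y - x < (1 - k0) / N1 k0 1 ->
  exists u v c, [/\ 0 <= c, x = u + c, y = v + c, N1 u v = 1 &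
    sx u v = u /\ sy u v = v].
Proof.
move=> /andP[k0l k0r] fixed /ler_normlP[x1 x2] y1 k0x yx.
have [yx2|yx2] := leP (y - x) 2.
  exists (-1), (y - x - 1), (x + 1).
  have t1 : `|y - x - 1| <= 1 by rewrite ler_norml; lra.
  have [b1 b2] := fe_back emb t1.
  rewrite mul1r in b2; split=> //; [lra|ring|ring|exact: fn_faceN1].
pose f k := (1 - k) / N1 k 1.
have f_cont : {within `[-1, k0], continuous f}.
  apply: continuous_subspaceT => k; apply: cvgM.
    by apply: cvgB; [exact: cvg_cst | exact: cvg_id].
  apply: cvgV; first by rewrite gt_eqF // fn_radial_gt0.
  exact: fn_radial_continuous.
have fN1' : f (-1) = 2 by rewrite /f (fn_faceN1 fN1) ?normr1 // divr1 opprK.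
have fk0 : f k0 = (1 - k0) / N1 k0 1 by [].
have fval : Num.min (f (-1)) (f k0) <= y - x <= Num.max (f (-1)) (f k0).
  by rewrite fN1' fk0 ge_min le_max; apply/andP; split; apply/orP; [left|right]; lra.
have [k] := IVT k0l f_cont fval.
rewrite in_itv /= => kk0 fk.
have n0 := fn_radial_gt0 fN1 k.
have [s1 s2] := fixed k kk0; move/andP: kk0 => [kl kr].
exists (k / N1 k 1), (1 / N1 k 1), (x - k / N1 k 1); split => //.
(* If [c < 0], going from the fixed point to [(x, y)] along [-(1, 1)] would not increase the ratio
   abscissa/ordinate, as [k <= 1]; then [x / y <= k <= k0], against [k0 * y < x]. *)
- rewrite leNgt; apply/negP => c0.
  have v0 : 0 < 1 / N1 k 1 by rewrite divr_gt0.
  have e1 : k / N1 k 1 = k * (1 / N1 k 1) by field; lra.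
  have e2 : f k = 1 / N1 k 1 - k * (1 / N1 k 1) by rewrite /f; field; lra.
  rewrite e1 in c0; rewrite e2 in fk.
  set v := 1 / N1 k 1 in v0 c0 fk.
  have : 0 <= (k0 - k) * y by apply: mulr_ge0; lra.
  have : 0 <= (k * v - x) * (1 - k) by apply: mulr_ge0; lra.
  have : y = v - k * v + x by lra.
  nra.
- by ring.
- have : f k = 1 / N1 k 1 - k / N1 k 1 by rewrite /f; field; lra.
  by lra.
- exact: fn_arc_unit.
Qed.

(* In both norms the vectors of length c with abscissa c form a vertical
   segment whose top is c * (1, 1), which makes (x, y) extremal among the
   points at distance c from (u, v). *)
Lemma reached_le (N N' : R -> R -> R) u v c x y x' y' :
  face_norm N -> face_norm N' -> 0 <= c -> x = u + c -> y = v + c ->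
  N' (x' - u) (y' - v) = N (x - u) (y - v) ->
  x' <= x /\ (x' = x -> y' <= y).
Proof.
move=> fN fN' c0 -> ->.
have -> : u + c - u = c by ring.
have -> : v + c - v = c by ring.
have -> : N c c = c by rewrite -{3}(ger0_norm c0); apply/(fn_face fN).
move=> Nc; have := fn_ge fN' (x' - u) (y' - v); rewrite Nc.
move=> /ler_normlP[_ ?]; split; first by lra.
move=> xc; have : N' (x' - u) (y' - v) = `|x' - u|.
  by rewrite Nc xc addrAC subrr add0r ger0_norm.
move=> /(fn_face fN'); rewrite xc addrAC subrr add0r (ger0_norm c0).
by move=> /ler_normlP[_ ?]; lra.
Qed.

(** [reached_le] applies to the point and, with the two norms exchanged, to its image; the two
    comparisons are opposite. *)
Lemma reached_fixed x y u v c u' v' c' :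
  N1 x y = 1 -> 0 <= c -> 0 <= c' -> N1 u v = 1 -> N1 u' v' = 1 ->
  sx u v = u -> sy u v = v -> sx u' v' = u' -> sy u' v' = v' ->
  x = u + c -> y = v + c -> sx x y = u' + c' -> sy x y = v' + c' ->
  sx x y = x /\ sy x y = y.
Proof.
move=> Np c0 c0' Nw Nw' su sv su' sv' xc yc xc' yc'.
have d1 := fe_dist emb Np Nw; rewrite su sv in d1.
have d2 := fe_dist emb Np Nw'; rewrite su' sv' in d2.
have [l1 m1] := reached_le fN1 fN2 c0 xc yc d1.
have [l2 m2] := reached_le fN2 fN1 c0' xc' yc' (esym d2).
have e : sx x y = x by apply/eqP; rewrite eq_le l1 l2.
by split=> //; apply/eqP; rewrite eq_le m1 // m2.
Qed.

Lemma arc_image_upper k : -1 <= k <= 1 ->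
  1 <= sy (k / N1 k 1) (1 / N1 k 1).
Proof.
move=> /andP[kl kr]; have n0 := fn_radial_gt0 fN1 k.
have Np := fn_arc_unit fN1 k.
have y1 : 1 <= 1 / N1 k 1.
  by rewrite ler_pdivlMr // mul1r fn_x1 // ler_norml kl.
set x := k / N1 k 1 in Np *; set y := 1 / N1 k 1 in Np y1 *.
have [x1|x1] := ltP `|x| 1.
  by have [|_ ->] := fe_upper fN1 fN2 emb Np x1 _; [lra|].
have xe : `|x| = 1 by apply/eqP; rewrite eq_le x1 (fn_unit_le1 fN1 Np).
have y1' : `|y| <= 1 by rewrite -xe; apply/(fn_face fN1); rewrite Np xe.
have [e|e] : x = 1 \/ x = -1.
    by move/eqP: xe; rewrite eqr_norml ler01 andbT => /orP[]/eqP; tauto.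
- by rewrite e; have [_ ->] := fe_front emb y1'.
- by rewrite e; have [_ ->] := fe_back emb y1'; rewrite mul1r.
Qed.

(** By the last hypothesis, the line parallel to [(1, 1)] through the point of [k1] meets, to its
    left, the fixed arc or the face at -1. This persists for nearby points and for their images,
    which stay near the same fixed point, and [reached_fixed] concludes. *)
Lemma arc_extend k0 k1 : -1 <= k0 -> k0 < k1 -> k1 <= 1 ->
  (forall k, -1 <= k <= k0 -> arc_fixed N1 sx sy k) -> arc_fixed N1 sx sy k1 ->
  (1 - k1) / N1 k1 1 < (1 - k0) / N1 k0 1 ->
  exists2 d, 0 < d & forall k, -1 <= k <= 1 -> `|k - k1| < d ->
    arc_fixed N1 sx sy k.
Proof.
move=> k0l k01 k1r fixed fixed1 gap.
have n1 := fn_radial_gt0 fN1 k1.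
have p1 := fn_radial_gt0 fN1 0; have p2 := fn_radial_gt0 fN2 0.
set x1 := k1 / N1 k1 1; set y1 := 1 / N1 k1 1.
have y10 : 0 < y1 by rewrite divr_gt0.
(* [e] is the slack at [k1] in the two strict inequalities required by [arc_reach]. *)
pose e := Num.min (x1 - k0 * y1) ((1 - k0) / N1 k0 1 - (y1 - x1)).
have e0 : 0 < e.
  rewrite lt_min; apply/andP; split.
    have -> : x1 - k0 * y1 = (k1 - k0) * y1 by rewrite /x1 /y1; field; lra.
    by rewrite mulr_gt0 //; lra.
  have <- : (1 - k1) / N1 k1 1 = y1 - x1 by rewrite /x1 /y1; field; lra.
  lra.
(* [C] times either norm dominates [|a| + |b|]. *)
pose C := 1 + (2 / N1 0 1 + 2 / N2 0 1).
have q1 : 0 < 2 / N1 0 1 by rewrite divr_gt0.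
have q2 : 0 < 2 / N2 0 1 by rewrite divr_gt0.
have C0 : 0 < C by rewrite /C; lra.
have coord N a b : face_norm N -> 2 / N 0 1 <= C - 1 ->
    `|a| + `|b| <= C * N a b.
  move=> fN NC; have p := fn_radial_gt0 fN 0.
  have := fn_ge fN a b; have := fn_ge0 fN a b.
  have : `|b| <= 2 / N 0 1 * N a b.
    by rewrite mulrAC ler_pdivlMr // fn_y_le.
  nra.
have near1 x y : `|x - x1| + `|y - y1| < e ->
    k0 * y < x /\ y - x < (1 - k0) / N1 k0 1.
  rewrite lt_min => /andP[H1 H2].
  have := ler_norm (x1 - x); have := ler_norm (y - y1).
  have k0n : `|k0| <= 1 by rewrite ler_norml; lra.
  have : k0 * (y - y1) <= `|y - y1|.
    apply: (le_trans (ler_norm _)); rewrite normrM.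
    by apply: ler_piMl.
  rewrite (distrC x1 x); split; lra.
have q4 : 0 < C * (4 / N1 0 1) by apply: mulr_gt0 => //; apply: divr_gt0.
exists (e / (C * (4 / N1 0 1))).
  by apply: divr_gt0.
move=> k kk kd; have Np := fn_arc_unit fN1 k.
have n0 := fn_radial_gt0 fN1 k.
have y1' : 1 <= 1 / N1 k 1.
  by rewrite ler_pdivlMr // mul1r fn_x1 // ler_norml.
have sy1 := arc_image_upper kk.
have Nd : C * N1 (k / N1 k 1 - x1) (1 / N1 k 1 - y1) < e.
  move: kd; rewrite ltr_pdivlMr // => kd.
  have := fn_arc_lip fN1 k k1 => /(ler_wpM2l (ltW C0)); lra.
have [s1 t1] := fixed1.
have Nd' := fe_dist emb Np (fn_arc_unit fN1 k1).
rewrite s1 t1 -/x1 -/y1 in Nd'.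
have c1 : 2 / N1 0 1 <= C - 1 by rewrite /C; lra.
have c2 : 2 / N2 0 1 <= C - 1 by rewrite /C; lra.
have k0b : -1 <= k0 <= 1 by lra.
have [a1 b1] := near1 _ _ (le_lt_trans (coord _ _ _ fN1 c1) Nd).
rewrite -Nd' in Nd.
have [a2 b2] := near1 _ _ (le_lt_trans (coord _ _ _ fN2 c2) Nd).
have [u [v [c [c0 xc yc Nw [su sv]]]]] :=
  arc_reach k0b fixed (fn_unit_le1 fN1 Np) y1' a1 b1.
have [u' [v' [c' [c0' xc' yc' Nw' [su' sv']]]]] :=
  arc_reach k0b fixed (fn_unit_le1 fN2 (fe_unit emb Np)) sy1 a2 b2.
exact: (reached_fixed Np c0 c0' Nw Nw').
Qed.

(** The map is continuous, being isometric: if [q] is fixed and near [p], the image of [p] is near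
    [q], hence near [p]. *)
Lemma arc_fixed_closed k :
  (forall d, 0 < d -> exists2 l, `|k - l| < d & arc_fixed N1 sx sy l) ->
  arc_fixed N1 sx sy k.
Proof.
move=> adh; have Np := fn_arc_unit fN1 k.
have p1 := fn_radial_gt0 fN1 0; have p2 := fn_radial_gt0 fN2 0.
set x := k / N1 k 1 in Np; set y := 1 / N1 k 1 in Np.
(* One unit pays for the distance between images; the rest is the constant of [fn_equiv] for passing
   from [N1] to [N2]. *)
pose C := 2 + 2 * (N2 0 1 / N1 0 1).
have C0 : 0 < C by rewrite /C; have := divr_gt0 p2 p1; lra.
have N20 : N2 (sx x y - x) (sy x y - y) <= 0.
  rewrite leNgt; apply/negP => e0.
  set e := N2 _ _ in e0.
  have q4 : 0 < C * (4 / N1 0 1) by apply: mulr_gt0 => //; apply: divr_gt0.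
  have d0 : 0 < e / (C * (4 / N1 0 1)) by apply: divr_gt0.
  have [l kl [sl tl]] := adh _ d0.
  move: kl; rewrite ltr_pdivlMr // => kl.
  have Nl := fn_arc_unit fN1 l.
  have := fe_dist emb Np Nl; rewrite sl tl.
  have := fn_arc_lip fN1 k l; rewrite -/x -/y.
  set x' := l / N1 l 1; set y' := 1 / N1 l 1 => lip dst.
  have := fnD fN2 (sx x y - x') (sy x y - y') (x' - x) (y' - y).
  rewrite !addrA !subrK -/e dst -(opprB x) -(opprB y) (fn_opp fN2).
  have := fn_equiv (x - x') (y - y') fN1 fN2.
  have := ler_wpM2l (ltW C0) lip; rewrite /C in kl *; lra.
have := fn_ge fN2 (sx x y - x) (sy x y - y) => H.
have /eqP : sx x y - x = 0 by apply/eqP; rewrite -normr_le0; lra.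
rewrite subr_eq0 => /eqP xe; rewrite xe subrr in N20.
split => //; apply/eqP; rewrite -subr_eq0; apply/eqP.
have [//|ne] := eqVneq (sy x y - y) 0.
by have := fn_0y_gt0 fN2 ne; lra.
Qed.

End Extension.

(** * Rigidity of the whole planar sphere *)

Lemma maximal_initial_segment (R : realType) (P : R -> Prop) :
  P (-1) ->
  (forall k, (forall d, 0 < d -> exists2 l, `|k - l| < d & P l) -> P k) ->
  exists k0, [/\ -1 <= k0 <= 1, forall k, -1 <= k <= k0 -> P k &
    k0 < 1 -> forall d, 0 < d ->
      exists k, [/\ `|k - k0| < d, -1 <= k <= 1 & ~ P k] ].
Proof.
move=> Pm1 Pcl.
(* The witness is the supremum of [A]: closedness makes [P] hold there, and points where [P] fails
   accumulate at it, since otherwise [A] would extend further. *)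
pose A : set R := [set a | -1 <= a <= 1 /\ forall k, -1 <= k <= a -> P k].
have Am1 : A (-1).
  split; first by lra.
  by move=> k kk; have -> : k = -1 by lra.
have supA : has_sup A by split; [exists (-1) | exists 1 => a [/andP[_ ?]]].
have supr : sup A <= 1 by apply: ge_sup => [|a [/andP[_ ?]]]; [exists (-1)|].
have supl : -1 <= sup A by apply: ub_le_sup => //; case: supA.
have below k : -1 <= k -> k < sup A -> P k.
  move=> kl kr; have kr' : 0 < sup A - k by lra.
  have [a [_ aP] ak] := sup_adherent kr' supA; apply: aP; lra.
have Psup : P (sup A).
  apply: Pcl => d d0; have [s1|s1] := eqVneq (sup A) (-1).
    by rewrite s1; exists (-1) => //; rewrite subrr normr0.
  have {s1}supl : -1 < sup A by rewrite lt_neqAle eq_sym s1.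
  have m1 : -1 <= Num.max (-1) (sup A - d / 2) by rewrite le_max lexx.
  have m2 : Num.max (-1) (sup A - d / 2) < sup A by rewrite gt_max supl /=; lra.
  have m3 : sup A - d / 2 <= Num.max (-1) (sup A - d / 2) by rewrite le_max lexx orbT.
  exists (Num.max (-1) (sup A - d / 2)); last exact: below.
  by rewrite ger0_norm; lra.
exists (sup A); split; first by rewrite supl.
  move=> k /andP[kl]; rewrite le_eqVlt => /orP[/eqP-> //|]; exact: below.
move=> s1 d d0; apply: contrapT => none.
have m1 : sup A < Num.min 1 (sup A + d / 2) by rewrite lt_min s1 /=; lra.
have m2 : Num.min 1 (sup A + d / 2) <= 1 by rewrite ge_min lexx.
have m3 : Num.min 1 (sup A + d / 2) <= sup A + d / 2 by rewrite ge_min lexx orbT.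
have : A (Num.min 1 (sup A + d / 2)).
  split; first by lra.
  move=> k /andP[kl kr]; have [ks|ks] := ltP k (sup A); first exact: below.
  apply: contrapT => nP; apply: none; exists k; split => //; last by lra.
  by rewrite ger0_norm; lra.
move=> /(ub_le_sup supA.2); lra.
Qed.

(** Reflection in the vertical axis turns the direction [(1, 1)] into [(-1, 1)], so propagation is
    proved for one direction only. *)
Lemma face_norm_mirror (R : realType) (N : R -> R -> R) :
  face_norm N -> face_norm (fun x y => N (- x) y).
Proof.
move=> fN; split.
- by move=> c x y; rewrite -mulrN (fnZ fN).
- by move=> x y x' y'; rewrite opprD (fnD fN).
- by move=> x y; rewrite -(normrN x) (fn_ge fN).
- by move=> x y; rewrite -(normrN x); apply: fn_face.
Qed.

Section Rigidity.
Context (R : realType) (N1 N2 sx sy : R -> R -> R).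
Context (fN1 : face_norm N1) (fN2 : face_norm N2).
Context (emb : face_embedding N1 N2 sx sy 1).

Lemma face_embedding_mirror :
  face_embedding (fun x y => N1 (- x) y) (fun x y => N2 (- x) y)
    (fun x y => - sx (- x) y) (fun x y => sy (- x) y) 1.
Proof.
split; last by left.
- by move=> x y Np; rewrite opprK; apply: (fe_unit emb).
- move=> x y x' y' Np Nq; rewrite opprD !opprK (fe_dist emb) //.
  by rewrite opprD opprK.
- by move=> t t1; have [-> ->] := fe_back emb t1; rewrite opprK mul1r.
- by move=> t t1; rewrite opprK mul1r; have [-> ->] := fe_front emb t1.
Qed.

Lemma arc_fixed_mirror k :
  arc_fixed (fun x y => N1 (- x) y) (fun x y => - sx (- x) y)
    (fun x y => sy (- x) y) k <-> arc_fixed N1 sx sy (- k).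
Proof.
rewrite /arc_fixed mulNr; split => -[e1 e2]; split => //.
  by rewrite -[LHS]opprK e1.
by rewrite e1 opprK.
Qed.

(** Conjugation by the central symmetry reduces the lower arc to the upper one. *)
Lemma face_embedding_opp :
  face_embedding N1 N2 (fun x y => - sx (- x) (- y))
    (fun x y => - sy (- x) (- y)) 1.
Proof.
split; last by left.
- move=> x y Np; rewrite (fn_opp fN2); apply: (fe_unit emb).
  by rewrite (fn_opp fN1).
- move=> x y x' y' Np Nq; rewrite -!opprD (fn_opp fN2) (fe_dist emb).
  + by rewrite -!opprD (fn_opp fN1).
  + by rewrite (fn_opp fN1).
  + by rewrite (fn_opp fN1).
- move=> t t1; rewrite -(normrN t) in t1.
  by have [-> ->] := fe_back emb t1; rewrite mul1r !opprK.
- move=> t t1; rewrite -(normrN t) in t1; rewrite opprK mul1r.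
  by have [-> ->] := fe_front emb t1; rewrite !opprK.
Qed.

End Rigidity.

Lemma upper_arc_fixed (R : realType) (N1 N2 sx sy : R -> R -> R) k :
  face_norm N1 -> face_norm N2 -> face_embedding N1 N2 sx sy 1 ->
  -1 <= k <= 1 -> arc_fixed N1 sx sy k.
Proof.
move=> fN1 fN2 emb kk.
have t1 : `|1 : R| <= 1 by rewrite normr1.
have fN1' := face_norm_mirror fN1; have fN2' := face_norm_mirror fN2.
have emb' := face_embedding_mirror emb.
have start (M1 M2 tx ty : R -> R -> R) : face_norm M1 -> face_norm M2 ->
    face_embedding M1 M2 tx ty 1 -> arc_fixed M1 tx ty (-1).
  move=> fM1 fM2 e; rewrite /arc_fixed (fn_faceN1 fM1) ?normr1 // !divr1.
  by have [-> ->] := fe_back e t1; rewrite mul1r.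
have [k0 [k0b k0P k0m]] := maximal_initial_segment
  (start _ _ _ _ fN1 fN2 emb) (arc_fixed_closed fN1 fN2 emb).
have [k1 [k1b k1P k1m]] := maximal_initial_segment
  (start _ _ _ _ fN1' fN2' emb') (arc_fixed_closed fN1' fN2' emb').
(* The second fixed arc is measured in the mirrored parameter. *)
have k1P' l : - k1 <= l <= 1 -> arc_fixed N1 sx sy l.
  move=> ll; rewrite -[l]opprK; apply/arc_fixed_mirror; apply: k1P; lra.
have [k01|k01] := leP (- k1) k0.
  by have [?|?] := leP k k0; [apply: k0P | apply: k1P']; lra.
have n0 := fn_radial_gt0 fN1 k0; have n1 := fn_radial_gt0 fN1 (- k1).
(* The chord joining the ends of the two fixed arcs fails to be parallel to
   (1, 1) or fails to be parallel to (-1, 1). *)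
have [gap|gap] := ltP ((1 - - k1) / N1 (- k1) 1) ((1 - k0) / N1 k0 1).
  have k1f : arc_fixed N1 sx sy (- k1) by apply: k1P'; lra.
  have k0l : -1 <= k0 by lra.
  have k1r : - k1 <= 1 by lra.
  (* The arc up to [k0] prolongs the other one past its end [- k1], against the maximality of
     [k1]. *)
  have [d d0 ext] := arc_extend fN1 fN2 emb k0l k01 k1r k0P k1f gap.
  have [|l [ld ll nf]] := k1m _ _ d0; first by lra.
  case: nf; apply/arc_fixed_mirror; apply: ext; first by lra.
  by rewrite -opprD normrN.
have k0f : arc_fixed (fun x y => N1 (- x) y) (fun x y => - sx (- x) y)
    (fun x y => sy (- x) y) (- k0).
  by apply/arc_fixed_mirror; rewrite opprK; apply: k0P; lra.
(* As [k0 < - k1], the failure of [gap] makes the ordinate larger at [- k1] than at [k0], so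
   ordinate plus abscissa is larger there too. *)
have gap' : (1 - - k0) / N1 (- - k0) 1 < (1 - k1) / N1 (- k1) 1.
  rewrite !opprK.
  have i0 : 0 < (N1 k0 1)^-1 by rewrite invr_gt0.
  have i1 : 0 < (N1 (- k1) 1)^-1 by rewrite invr_gt0.
  have : (N1 k0 1)^-1 < (N1 (- k1) 1)^-1.
    rewrite ltNge; apply/negP => H; nra.
  nra.
have k01' : k1 < - k0 by lra.
have k1l : -1 <= k1 by lra.
have k0r : - k0 <= 1 by lra.
have [d d0 ext] := arc_extend fN1' fN2' emb' k1l k01' k0r k1P k0f gap'.
have [|l [ld ll nf]] := k0m _ _ d0; first by lra.
case: nf; rewrite -[l]opprK; apply/arc_fixed_mirror; apply: ext; first by lra.
by rewrite -opprD normrN.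
Qed.

Lemma face_embedding_fixed_upper (R : realType) (N1 N2 sx sy : R -> R -> R) x y :
  face_norm N1 -> face_norm N2 -> face_embedding N1 N2 sx sy 1 ->
  N1 x y = 1 -> `|x| < 1 -> 0 < y -> sx x y = x /\ sy x y = y.
Proof.
move=> fN1 fN2 emb Np x1 y0.
have y1 : 1 <= y by have := fn_unit_ge1 fN1 Np x1; rewrite gtr0_norm.
have kk : -1 <= x / y <= 1.
  move/ltr_normlP: x1 => [x1 x2].
  by rewrite ler_pdivlMr // ler_pdivrMr //; lra.
have := upper_arc_fixed fN1 fN2 emb kk; rewrite /arc_fixed.
have Nk : N1 (x / y) 1 = y^-1.
  have := fnZ fN1 y^-1 x y; rewrite Np mulr1 mulVf ?gt_eqF // mulrC => ->.
  by rewrite ger0_norm // invr_ge0 ltW.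
by rewrite Nk invrK mul1r divfK ?gt_eqF.
Qed.

Lemma face_embedding_id (R : realType) (N1 N2 sx sy : R -> R -> R) eps x y :
  face_norm N1 -> face_norm N2 -> face_embedding N1 N2 sx sy eps ->
  N1 x y = 1 -> sx x y = x /\ sy x y = y.
Proof.
move=> fN1 fN2 emb Np.
(* [fe_upper] at the upper point of the vertical axis excludes the flip. *)
have e1 : eps = 1.
  have n0 := fn_radial_gt0 fN1 0; have := fn_arc_unit fN1 0.
  rewrite mul0r => N0.
  by have [||_ _ ->] := fe_upper fN1 fN2 emb N0; rewrite ?normr0 ?divr_gt0.
rewrite {}e1 in emb.
have [x1|x1] := ltP `|x| 1.
  have y1 := fn_unit_ge1 fN1 Np x1.
  have [y0|y0] := ltP 0 y; first exact: (face_embedding_fixed_upper fN1 fN2 emb).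
  have emb' := face_embedding_opp fN1 fN2 emb.
  have [|||] := face_embedding_fixed_upper (x := - x) (y := - y) fN1 fN2 emb'.
  - by rewrite (fn_opp fN1).
  - by rewrite normrN.
  - by move: y1; rewrite ler0_norm //; lra.
  by rewrite !opprK => /oppr_inj -> /oppr_inj ->.
have xe : `|x| = 1 by apply/eqP; rewrite eq_le x1 (fn_unit_le1 fN1 Np).
have y1' : `|y| <= 1 by rewrite -xe; apply/(fn_face fN1); rewrite Np xe.
have [e|e] : x = 1 \/ x = -1.
    by move/eqP: xe; rewrite eqr_norml ler01 andbT => /orP[]/eqP; tauto.
- by rewrite e; apply: (fe_front emb).
- by rewrite e; have [-> ->] := fe_back emb y1'; rewrite mul1r.
Qed.

(** * Maximal segments in a unit sphere *)

Section LineInSphere.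
Context (R : realType) (V : normedModType R).
Implicit Types u v : V.

(** A convex function constant on [[-1, 1]] is nowhere smaller: for [|t| > 1], [u + v] or [u - v]
    lies between [u] and [u + t *: v]. *)
Lemma line_norm_ge1 u v :
  (forall t, `|t| <= 1 -> `|u + t *: v| = 1) -> forall t, 1 <= `|u + t *: v|.
Proof.
move=> seg t; have [t1|t1] := leP `|t| 1; first by rewrite seg.
have t0 : 0 < `|t| by lra.
set c := `|t|^-1; have c0 : 0 <= c by rewrite invr_ge0 ltW.
have c1 : c <= 1 by rewrite invf_le1 // ltW.
have Nu : `|u| = 1 by rewrite -[u](addr0) -(scale0r v) seg // normr0.
have Nt : `|u + (c * t) *: v| = 1.
  by rewrite seg // normrM ger0_norm // mulVf ?gt_eqF.
have dec : u + (c * t) *: v = (1 - c) *: u + c *: (u + t *: v).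
  by rewrite scalerDr scalerA addrA -scalerDl subrK scale1r.
have := ler_normD ((1 - c) *: u) (c *: (u + t *: v)).
rewrite -dec Nt !normrZ Nu (ger0_norm c0) ger0_norm; last by lra.
have cp : 0 < c by rewrite invr_gt0.
move=> H; have : c * 1 <= c * `|u + t *: v| by lra.
by rewrite ler_pM2l.
Qed.

Lemma face_norm_of_segment u v :
  (forall t, `|u + t *: v| = 1 <-> `|t| <= 1) ->
  face_norm (fun x y => `|x *: u + y *: v|).
Proof.
move=> seg; have ge1 := line_norm_ge1 (fun t => (seg t).2).
have scale x y : x != 0 -> `|x *: u + y *: v| = `|x| * `|u + (y / x) *: v|.
  by move=> x0; rewrite -normrZ scalerDr scalerA mulrC divfK.
have v0 : 0 < `|v|.
  rewrite normr_gt0; apply/eqP => v0.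
  have : `|2 : R| <= 1.
    by apply/seg; rewrite v0 scaler0 -(scaler0 V 0) -v0; apply/seg; rewrite normr0.
  by rewrite ger0_norm //; lra.
split.
- by move=> c x y; rewrite -normrZ scalerDr !scalerA.
- move=> x y x' y'; rewrite !scalerDl addrACA; exact: ler_normD.
- move=> x y; have [->|x0] := eqVneq x 0; first by rewrite normr0.
  by rewrite scale // ler_peMr.
- move=> x y; have [->|x0] := eqVneq x 0.
    rewrite scale0r add0r normr0 normrZ normr_le0; split => [/eqP|/eqP ->].
      by rewrite mulf_eq0 (gt_eqF v0) orbF normr_eq0.
    by rewrite normr0 mul0r.
  have x1 : 0 < `|x| by rewrite normr_gt0.
  rewrite scale //; split => [|yx].
    rewrite -[RHS]mulr1 => /(mulfI (lt0r_neq0 x1))/seg.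
    by rewrite normrM normfV ler_pdivrMr // mul1r.
  rewrite (seg _).2 ?mulr1 //.
  by rewrite normrM normfV ler_pdivrMr // mul1r.
Qed.

(** [t] is the supremum of the parameters on the sphere: they are bounded by [2 / |v|], and the norm
    is continuous along the line. *)
Lemma segment_end u v : v != 0 ->
  (forall s, 0 <= s <= 1 -> `|u + s *: v| = 1) ->
  exists t, [/\ 1 <= t, `|u + t *: v| = 1 &
    forall s, `|u + s *: v| = 1 -> s <= t].
Proof.
move=> v0 seg; have nv : 0 < `|v| by rewrite normr_gt0.
pose A : set R := [set s | `|u + s *: v| = 1].
have A1 : A 1 by apply: seg; rewrite ler01 lexx.
have Nu : `|u| = 1 by rewrite -[u]addr0 -(scale0r v) seg // lexx ler01.
have ubA s : A s -> s <= 2 / `|v|.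
  move=> As; rewrite ler_pdivlMr //; apply: (le_trans (ler_wpM2r (ltW nv) (ler_norm s))).
  rewrite -normrZ -(addKr u (s *: v)).
  by apply: (le_trans (ler_normD _ _)); rewrite normrN Nu As.
have supA : has_sup A by split; [exists 1 | exists (2 / `|v|)].
have sup1 : 1 <= sup A by apply: ub_le_sup => //; case: supA.
exists (sup A); split => //; last by move=> s As; apply: ub_le_sup => //; case: supA.
apply/eqP; rewrite -subr_eq0 -normr_le0 leNgt; apply/negP => d0.
have d1 : 0 < `| `|u + sup A *: v| - 1| / `|v| by apply: divr_gt0.
have [s As sl] := sup_adherent d1 supA.
have su : s <= sup A by apply: ub_le_sup => //; case: supA.
have : `| `|u + sup A *: v| - 1| <= (sup A - s) * `|v|.
  have {1}<- : `|u + s *: v| = 1 := As.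
  apply: (le_trans (ler_dist_dist _ _)).
  by rewrite opprD addrACA subrr add0r -scalerBl normrZ ger0_norm ?subr_ge0.
rewrite -ler_pdivrMr //; lra.
Qed.

Lemma maximal_segment : ~ strictly_convex V ->
  exists u v, forall t, `|u + t *: v| = 1 <-> `|t| <= 1.
Proof.
move=> nsc; have [x [y [xy sub]]] :
    exists x y : V, x <> y /\ segment x y `<=` unit_sphere V.
  apply: contrapT => none; apply: nsc => x y xy sub.
  by apply: none; exists x, y.
pose w := y - x; have w0 : w != 0 by rewrite subr_eq0; apply/eqP => /esym.
have seg s : 0 <= s <= 1 -> `|x + s *: w| = 1.
  move=> s01; apply: sub; exists s; first by rewrite /= in_itv.
  by rewrite /w scalerBr scalerBl scale1r -addrA [- _ + _]addrC.
clearbody w; have [t2 [t21 Nt2 t2m]] := segment_end w0 seg.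
have seg' s : 0 <= s <= 1 -> `|(x + w) + s *: (- w)| = 1.
  move=> s01; rewrite -addrA scalerN -{1}[w]scale1r -scalerBl; apply: seg; lra.
have w0' : - w != 0 by rewrite oppr_eq0.
have [t1 [t11 Nt1 t1m]] := segment_end w0' seg'.
have conv s : (x + w) + s *: (- w) = x + (1 - s) *: w.
  by rewrite -addrA scalerN -{1}[w]scale1r -scalerBl.
rewrite conv in Nt1.
(* [c] is the midpoint and [r] the half-length of the parameter interval [[1 - t1, t2]]. *)
pose c := (t2 + (1 - t1)) / 2; pose r := (t2 - (1 - t1)) / 2.
have r0 : 0 < r by rewrite /r; lra.
have line t : (x + c *: w) + t *: (r *: w) = x + (c + t * r) *: w.
  by rewrite -addrA scalerA -scalerDl.
exists (x + c *: w), (r *: w) => t; rewrite line; split.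
  move=> Nt; have := t2m _ Nt.
  have := t1m (1 - (c + t * r)); rewrite conv subKr => /(_ Nt).
  move=> H1 H2.
  have H3 : t * r <= 1 * r by rewrite mul1r /c /r in H1 H2 *; lra.
  have H4 : (-1) * r <= t * r by rewrite mulN1r /c /r in H1 H2 *; lra.
  by rewrite ler_norml; move: H3 H4; rewrite !ler_pM2r // => -> ->.
move=> /ler_normlP[tl tr].
have ge1 s : 1 <= `|x + s *: w|.
  have half h : `|h| <= 1 -> `|(x + 2^-1 *: w) + h *: (2^-1 *: w)| = 1.
    move=> /ler_normlP[hl hr].
    by rewrite -addrA scalerA -scalerDl; apply: seg; lra.
  have := line_norm_ge1 half (2 * s - 1).
  rewrite -addrA scalerA -scalerDl.
  by have -> : 2^-1 + (2 * s - 1) * 2^-1 = s by field.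
apply/eqP; rewrite eq_le ge1 andbT.
have dec : x + (c + t * r) *: w =
    ((1 + t) / 2) *: (x + t2 *: w) + ((1 - t) / 2) *: (x + (1 - t1) *: w).
  rewrite !scalerDr addrACA !scalerA -(scalerDl x) -(scalerDl w).
  have -> : (1 + t) / 2 + (1 - t) / 2 = 1 by field.
  by rewrite scale1r /c /r; congr (_ + _ *: _); field.
rewrite dec; apply: (le_trans (ler_normD _ _)).
by rewrite !normrZ Nt2 Nt1 !ger0_norm; lra.
Qed.

Lemma coordinates_unique u v x y x' y' :
  (forall t, `|u + t *: v| = 1 <-> `|t| <= 1) ->
  x *: u + y *: v = x' *: u + y' *: v -> x = x' /\ y = y'.
Proof.
move=> /face_norm_of_segment fN /eqP; rewrite -subr_eq0 opprD addrACA -!scalerBl.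
move=> /eqP e0; have := fn_ge fN (x - x') (y - y'); rewrite /= e0 normr0 normr_le0.
rewrite subr_eq0 => /eqP xx; split=> //.
apply/eqP; rewrite -subr_eq0; apply/negP => /negP /(fn_0y_gt0 fN) /=.
by move: e0; rewrite xx subrr => ->; rewrite normr0 ltxx.
Qed.

(** Cramer's rule; a vanishing determinant would, by uniqueness of coordinates, force [u = 0]. *)
Lemma coordinates_exist u v : has_dimension V 2 ->
  (forall t, `|u + t *: v| = 1 <-> `|t| <= 1) ->
  forall z, exists x y, z = x *: u + y *: v.
Proof.
move=> [b [span _]] seg.
have coord z : exists x y, z = x *: b ord0 + y *: b (lift ord0 ord0).
  have [a ->] := span z; exists (a ord0), (a (lift ord0 ord0)).
  by rewrite big_ord_recl big_ord1.
set b0 := b ord0 in coord; set b1 := b _ in coord.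
have [u0 [u1 ue]] := coord u; have [v0 [v1 ve]] := coord v.
have elim0 : v1 *: u + - u1 *: v = (u0 * v1 - u1 * v0) *: b0.
  rewrite ue ve !scalerDr !scalerA addrACA -!scalerDl.
  have -> : v1 * u1 + - u1 * v1 = 0 by ring.
  by rewrite scale0r addr0; congr (_ *: _); ring.
have elim1 : - v0 *: u + u0 *: v = (u0 * v1 - u1 * v0) *: b1.
  rewrite ue ve !scalerDr !scalerA addrACA -!scalerDl.
  have -> : - v0 * u0 + u0 * v0 = 0 by ring.
  by rewrite scale0r add0r; congr (_ *: _); ring.
have d0 : u0 * v1 - u1 * v0 != 0.
  apply/eqP => d0; rewrite d0 !scale0r in elim0 elim1.
  have zero : 0 = (0 : R) *: u + 0 *: v by rewrite !scale0r addr0.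
  rewrite {}zero in elim0 elim1.
  have [_ /eqP] := coordinates_unique seg elim0.
  have [_ /eqP] := coordinates_unique seg elim1.
  rewrite oppr_eq0 => /eqP e0 /eqP e1.
  have : `|u + 0 *: v| = 1 by apply/seg; rewrite normr0.
  rewrite ue e0 e1 !scale0r !addr0 normr0 => /eqP.
  by rewrite eq_sym oner_eq0.
move=> z; have [z0 [z1 ->]] := coord z.
set d := u0 * v1 - u1 * v0 in d0 elim0 elim1.
have b0e : b0 = d^-1 *: (v1 *: u + - u1 *: v) by rewrite elim0 scalerA mulVf // scale1r.
have b1e : b1 = d^-1 *: (- v0 *: u + u0 *: v) by rewrite elim1 scalerA mulVf // scale1r.
rewrite b0e b1e !scalerDr !scalerA addrACA -!scalerDl.
by do 2 eexists.
Qed.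

End LineInSphere.

(** * Opposite faces recognized by distances *)

Section MetricFaces.
Context (R : realType) (V : normedModType R).
Implicit Types (P Q : R -> V) (l : R).

(* P parametrizes the image of a face and Q minus the image of the opposite
   face, so that |P s + w| = 2 says that -w is at distance 2 from P s. *)
Definition star P Q l :=
  [/\ forall s, `|s| <= 1 -> `|P s| = 1,
      forall s t, `|s| <= 1 -> `|t| <= 1 -> `|P s - P t| = l * `|s - t|,
      forall s t, `|s| <= 1 -> `|t| <= 1 -> `|P s + Q t| = 2 &
      forall s w, `|s| < 1 -> `|w| = 1 -> `|P s + w| = 2 ->
        exists2 t, `|t| <= 1 & w = Q t].

(** The last clause of [star], applied to [P 0] twice, gives [P 0 = Q t] for some [t]; then
    [|P 0 + P s| = 2] and the same clause applies to [P s]. *)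
Lemma star_range P Q l s : star P Q l -> `|s| <= 1 ->
  exists2 t, `|t| <= 1 & P s = Q t.
Proof.
move=> [PN _ PQ Pst] s1.
have z0 : `|0 : R| < 1 by rewrite normr0.
have P2 : `|P 0 + P 0| = 2.
  by rewrite -mulr2n normrMn PN // ltW.
have [t t1 P0] := Pst _ _ z0 (PN _ (ltW z0)) P2.
by apply: (Pst 0) => //; [exact: PN | rewrite P0 addrC PQ].
Qed.

Lemma convex_coordinate (a b c k : R) : 0 <= k <= 1 ->
  `|c - a| = k * `|b - a| -> `|c - b| = (1 - k) * `|b - a| ->
  c = (1 - k) * a + k * b.
Proof.
move=> /andP[k0 k1].
have [ab|ab] := leP a b.
  rewrite (ger0_norm (_ : 0 <= b - a)) ?subr_ge0 // => h1 h2.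
  have := ler_norm (c - a); have := ler_norm (b - c).
  by rewrite (distrC b) h1 h2; lra.
rewrite (ltr0_norm (_ : b - a < 0)) ?subr_lt0 // => h1 h2.
have := ler_norm (a - c); have := ler_norm (c - b).
by rewrite (distrC a) h1 h2; lra.
Qed.

(** Since [|P s + P t| = 2], the norm is additive on the cone of [P s] and [P t]: the combination
    [v] has norm 1 and [|P s + v| = 2]. So [v] lies in the range of [Q], hence of [P], and its
    distances to [P s] and [P t] give its parameter. *)
Lemma star_convex P Q l s t k : 0 < l -> star P Q l -> star Q P l ->
  `|s| < 1 -> `|t| <= 1 -> 0 <= k <= 1 ->
  P ((1 - k) * s + k * t) = (1 - k) *: P s + k *: P t.
Proof.
move=> l0 stP stQ s1 t1 kk; have s1' := ltW s1.
have [PN Pd PQ Pst] := stP; move/andP: (kk) => [k0 k1].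
have Pst2 : `|P s + P t| = 2 by have [r r1 ->] := star_range stP t1; exact: PQ.
set v := _ + _ *: P t.
have Nv : `|v| = 1.
  apply/eqP; rewrite eq_le; apply/andP; split.
    apply: (le_trans (ler_normD _ _)).
    by rewrite !normrZ !PN // !ger0_norm; lra.
  have := ler_normD v (k *: P s + (1 - k) *: P t).
  have := ler_normD (k *: P s) ((1 - k) *: P t).
  rewrite !normrZ !PN // (ger0_norm k0) (ger0_norm (_ : 0 <= 1 - k)); last by lra.
  have -> : v + (k *: P s + (1 - k) *: P t) = P s + P t.
    rewrite /v addrACA -!scalerDl subrK.
    by rewrite [k + _]addrC subrK !scale1r.
  rewrite Pst2; lra.
have Nvs : `|P s + v| = 2.
  apply/eqP; rewrite eq_le; apply/andP; split.
    by apply: (le_trans (ler_normD _ _)); rewrite PN // Nv; lra.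
  have := ler_normD (P s + v) (k *: P s + (2 - k) *: P t).
  have := ler_normD (k *: P s) ((2 - k) *: P t).
  rewrite !normrZ !PN // (ger0_norm k0) (ger0_norm (_ : 0 <= 2 - k)); last by lra.
  have -> : P s + v + (k *: P s + (2 - k) *: P t) = 2 *: (P s + P t).
    rewrite /v [P s + (_ + _)]addrA -{1}[P s]scale1r -(scalerDl (P s)) addrACA.
    rewrite -(scalerDl (P s)) -(scalerDl (P t)) scalerDr.
    by congr (_ *: _ + _ *: _); ring.
  rewrite normrZ Pst2 ger0_norm //; lra.
have [r r1 vr] := Pst _ _ s1 Nv Nvs.
have [c c1 vc] := star_range stQ r1.
have e : v = P c by rewrite vr.
rewrite e; congr P; symmetry; apply: convex_coordinate => //.
  apply: (mulfI (lt0r_neq0 l0)); rewrite -(Pd _ _ c1 s1') -e.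
  have -> : v - P s = k *: (P t - P s).
    rewrite /v scalerBr scalerBl scale1r addrAC.
    by rewrite [P s - _]addrC addrK addrC.
  by rewrite normrZ ger0_norm // Pd // mulrCA.
apply: (mulfI (lt0r_neq0 l0)); rewrite -(Pd _ _ c1 t1) -e.
have -> : v - P t = (1 - k) *: (P s - P t).
  by rewrite /v scalerBr [(1 - k) *: P t]scalerBl scale1r opprB addrA.
by rewrite normrZ ger0_norm ?subr_ge0 // Pd // (distrC s) mulrCA.
Qed.

Lemma star_affine P Q l : 0 < l -> star P Q l -> star Q P l ->
  forall s, `|s| <= 1 -> P s = P 0 + s *: (P 1 - P 0).
Proof.
move=> l0 stP stQ.
have n11 : `|1 : R| <= 1 by rewrite normr1.
have nN11 : `|-1 : R| <= 1 by rewrite normrN1.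
have n0 : `|0 : R| < 1 by rewrite normr0.
have conv t k : `|t| <= 1 -> 0 <= k <= 1 -> P (k * t) = P 0 + k *: (P t - P 0).
  move=> t1 kk; have := star_convex l0 stP stQ n0 t1 kk.
  by rewrite mulr0 add0r => ->; rewrite scalerBl scale1r scalerBr addrAC addrA.
(* [star_convex] wants its first parameter inside the open interval, so [P 0] is taken as the
   midpoint of [P 2^-1] and [P (- 2^-1)]. *)
have PN1 : P (-1) - P 0 = - (P 1 - P 0).
  have nh : `|2^-1 : R| < 1 by rewrite ger0_norm; lra.
  have nh' : `|- 2^-1 : R| <= 1 by rewrite normrN ltW.
  have kh : 0 <= (2^-1 : R) <= 1 by lra.
  have := star_convex l0 stP stQ nh nh' kh.
  have -> : (1 - 2^-1) * 2^-1 + 2^-1 * - 2^-1 = 0 :> R by field.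
  have := conv 1 2^-1 n11 kh; rewrite mulr1 => ->.
  have := conv (-1) 2^-1 nN11 kh; rewrite mulrN1 => ->.
  have -> : 1 - 2^-1 = 2^-1 :> R by field.
  rewrite -scalerDr addrACA -(scalerDr _ (P 1 - P 0)).
  rewrite [2^-1 *: (P 0 + P 0 + _)]scalerDr -[P 0 + P 0]mulr2n.
  rewrite -(scaler_nat 2 (P 0)) !scalerA mulVf ?pnatr_eq0 // scale1r => /eqP.
  rewrite eq_sym -subr_eq0 addrAC subrr add0r scaler_eq0 mulf_eq0 invr_eq0.
  by rewrite pnatr_eq0 /= addrC addr_eq0 => /eqP.
move=> s s1; have [s0|s0] := leP 0 s.
  rewrite -{1}(mulr1 s); apply: conv => //.
  by rewrite s0 /=; rewrite ger0_norm in s1.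
have -> : s = (- s) * (-1) by ring.
rewrite conv // ?PN1; last by move: s1; rewrite ltr0_norm //; lra.
by rewrite scalerN -scaleNr mulrN1.
Qed.

Lemma star_segment P Q l : 0 < l -> star P Q l -> star Q P l ->
  exists u v eps, [/\ forall s, `|s| <= 1 -> P s = u + s *: v,
    forall s, `|s| <= 1 -> Q s = u + (eps * s) *: v,
    eps = 1 \/ eps = -1 &
    forall t, `|u + t *: v| = 1 <-> `|t| <= 1].
Proof.
move=> l0 stP stQ; have Paff := star_affine l0 stP stQ.
have [PN Pd PQ Pst] := stP; have [_ Qd _ _] := stQ.
have n11 : `|1 : R| <= 1 by rewrite normr1.
have nN11 : `|-1 : R| <= 1 by rewrite normrN1.
have n0 : `|0 : R| < 1 by rewrite normr0.
have lift r c r' c' : `|r| <= 1 -> `|c| <= 1 -> `|r'| <= 1 -> `|c'| <= 1 ->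
    Q r = P c -> Q r' = P c' -> `|c - c'| = `|r - r'|.
  move=> r1 c1 r1' c1' e e'; apply: (mulfI (lt0r_neq0 l0)).
  by rewrite -Pd // -Qd // e e'.
(* Read through [P], the map [Q] is an isometry of [[-1, 1]] into itself, so the ends go to the
   ends. *)
have [eps epsP Qe] : exists2 eps : R, eps = 1 \/ eps = -1 &
    forall s, `|s| <= 1 -> Q s = P (eps * s).
  have [c c1 Qc] := star_range stQ n11; have [d d1 Qd1] := star_range stQ nN11.
  have cd := lift _ _ _ _ n11 c1 nN11 d1 Qc Qd1.
  have n2 : `|1 - -1 : R| = 2 by rewrite opprK ger0_norm.
  rewrite {}n2 in cd.
  have [c1l c1r] := ler_normlP _ _ c1; have [d1l d1r] := ler_normlP _ _ d1.
  have [ce|ce] : c = 1 \/ c = -1.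
    have := leP 0 (c - d) => -[?|?]; [left|right].
      by rewrite ger0_norm // in cd; lra.
    by rewrite ltr0_norm // in cd; lra.
  - exists 1; first by left.
    move=> s s1; have [r r1 Qr] := star_range stQ s1.
    have := lift _ _ _ _ n11 c1 s1 r1 Qc Qr.
    have [sl sr] := ler_normlP _ _ s1; have [rl rr] := ler_normlP _ _ r1.
    by rewrite Qr ce mul1r !ger0_norm ?subr_ge0 // => e; congr P; lra.
  - exists (-1); first by right.
    move=> s s1; have [r r1 Qr] := star_range stQ s1.
    have := lift _ _ _ _ n11 c1 s1 r1 Qc Qr.
    have [sl sr] := ler_normlP _ _ s1; have [rl rr] := ler_normlP _ _ r1.
    rewrite Qr ce mulN1r distrC opprK !ger0_norm ?subr_ge0 //; last by lra.
    by move=> e; congr P; lra.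
have epsn : `|eps| = 1 by case: epsP => ->; rewrite ?normrN1 ?normr1.
have eps1 s : `|s| <= 1 -> `|eps * s| <= 1 by rewrite normrM epsn mul1r.
exists (P 0), (P 1 - P 0), eps; split => // [s s1|t].
  by rewrite Qe // Paff // eps1.
have seg s : `|s| <= 1 -> `|P 0 + s *: (P 1 - P 0)| = 1.
  by move=> s1; rewrite -Paff // PN.
have ge1 := line_norm_ge1 seg.
split; last exact: seg.
(* By [line_norm_ge1], the midpoint of [P 0] and any point of the line on the sphere has norm at
   least 1; the last clause of [star] then puts that point in the range of [Q]. *)
move=> Nt; have P2 : `|P 0 + (P 0 + t *: (P 1 - P 0))| = 2.
  apply/eqP; rewrite eq_le; apply/andP; split.
    by apply: (le_trans (ler_normD _ _)); rewrite PN ?(ltW n0) // Nt; lra.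
  have -> : P 0 + (P 0 + t *: (P 1 - P 0)) = 2 *: (P 0 + (2^-1 * t) *: (P 1 - P 0)).
    move: (P 1 - P 0) => d.
    by rewrite scalerDr scalerA mulVKf // addrA scaler_nat mulr2n.
  by rewrite normrZ ger0_norm //; have := ge1 (2^-1 * t); lra.
have [r r1 tr] := Pst _ _ n0 Nt P2.
have nz : P 1 - P 0 != 0 by rewrite -normr_eq0 Pd ?(ltW n0) // subr0 normr1 mulr1 gt_eqF.
move: tr; rewrite (Qe _ r1) (Paff _ (eps1 _ r1)) => /addrI /eqP.
rewrite -subr_eq0 -scalerBl scaler_eq0 (negPf nz) orbF subr_eq0 => /eqP ->.
exact: eps1.
Qed.

(** The midpoint of [u + s *: v] and [- w] is a unit vector and, as [s] is interior, it may be moved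
    up and down inside the ball. By [fn_lt] this forces its abscissa to be 1 in absolute value, so
    that of [w] is -1. *)
Lemma opposite_face (u v w : V) s :
  (forall z, exists x y, z = x *: u + y *: v) ->
  (forall t, `|u + t *: v| = 1 <-> `|t| <= 1) ->
  `|s| < 1 -> `|w| = 1 -> `|u + s *: v - w| = 2 ->
  exists2 t, `|t| <= 1 & w = - (u + t *: v).
Proof.
move=> span seg s1 Nw Nsw; have fN := face_norm_of_segment seg.
have [a [b we]] := span w; rewrite we in Nw Nsw.
set N := (fun x y => `|x *: u + y *: v|) in fN.
have Nab : N a b = 1 := Nw.
have [sl sr] := ltr_normlP _ _ s1.
pose x := (1 - a) / 2; pose y := (s - b) / 2.
have Nxy : N x y = 1.
  have -> : x = 2^-1 * (1 - a) by rewrite /x mulrC.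
  have -> : y = 2^-1 * (s - b) by rewrite /y mulrC.
  rewrite (fnZ fN) /N !scalerBl addrACA scale1r -opprD Nsw.
  by rewrite ger0_norm // mulVf.
have shift h : `|s + 2 * h| <= 1 -> N x (y + h) <= 1.
  move=> h1; have -> : x = 2^-1 * 1 + 2^-1 * - a by rewrite /x; field.
  have -> : y + h = 2^-1 * (s + 2 * h) + 2^-1 * - b by rewrite /y; field.
  apply: (le_trans (fnD fN _ _ _ _)).
  rewrite !(fnZ fN) (fn_opp fN) Nab (fn_face1 fN) // ger0_norm //; lra.
have [h h0 [hp hn]] : exists2 h, 0 < h & N x (y + h) <= 1 /\ N x (y - h) <= 1.
  exists ((1 - `|s|) / 2); first by rewrite divr_gt0 // subr_gt0.
  have := ler_norm s; have := ler_norm (- s); rewrite normrN => ? ?.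
  by split; apply: shift; rewrite ler_norml; lra.
have x1 := fn_unit_le1 fN Nxy; have a1 := fn_unit_le1 fN Nab.
have {}x1 : `|x| = 1.
  apply/eqP; rewrite eq_le x1 leNgt; apply/negP => xs.
  have := fn_unit_ge1 fN Nxy xs; rewrite ler_normr => /orP[y1|y1].
    have y0 : 0 <= y by lra.
    have yh : y < y + h by lra.
    have xy : `|x| < y + h by lra.
    by have := fn_lt fN y0 yh xy; lra.
  have y0 : y <= 0 by lra.
  have yh : y - h < y by lra.
  have xy : `|x| < - (y - h) by lra.
  by have := fn_lt_opp fN y0 yh xy; lra.
have {}ae : a = -1.
  move/ler_normlP: a1 => [al ar].
  by move: x1; rewrite /x ger0_norm; lra.
exists (- b).
  rewrite normrN; have <- : `|a| = 1 by rewrite ae normrN1.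
  by apply/(fn_face fN); rewrite Nab ae normrN1.
by rewrite we ae opprD !scaleNr scale1r opprK.
Qed.

End MetricFaces.

(** * Faces under a surjective isometry of spheres *)

Section SphereIsometry.
Context (R : realType) (X Y : normedModType R) (tau : X -> Y) (u v : X).
Context (tau_fun : set_fun (unit_sphere X) (unit_sphere Y) tau)
  (tau_surj : set_surj (unit_sphere X) (unit_sphere Y) tau)
  (tau_iso : isometry_on (unit_sphere X) tau)
  (span : forall z : X, exists x y, z = x *: u + y *: v)
  (seg : forall t, `|u + t *: v| = 1 <-> `|t| <= 1).

Let P s := tau (u + s *: v).
Let Q s := - tau (- (u + s *: v)).

Lemma direction_norm_gt0 : 0 < `|v|.
Proof.
have /= := fn_0y_gt0 (face_norm_of_segment seg) (oner_neq0 R).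
by rewrite scale0r add0r scale1r.
Qed.

Let opposite_norm s t : `|s| <= 1 -> `|t| <= 1 ->
  `|(u + s *: v) + (u + t *: v)| = 2.
Proof.
move=> s1 t1; rewrite addrACA -scalerDl -mulr2n -(scaler_nat 2 u).
have st : `|s + t| <= `|2 : R|.
  by apply: (le_trans (ler_normD _ _)); rewrite [in leRHS]ger0_norm //; lra.
by have /= -> := (fn_face (face_norm_of_segment seg) 2 (s + t)).2 st; rewrite ger0_norm.
Qed.

Let sphereP s : `|s| <= 1 -> unit_sphere X (u + s *: v).
Proof. by move/seg. Qed.

Let sphereN s : `|s| <= 1 -> unit_sphere X (- (u + s *: v)).
Proof. by move/seg; rewrite /unit_sphere /= normrN. Qed.

Let dist_line s t : `|(u + s *: v) - (u + t *: v)| = `|v| * `|s - t|.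
Proof.
by rewrite opprD addrACA subrr add0r -scalerBl normrZ mulrC.
Qed.

(** For the last clause, surjectivity writes [- w] as [tau p], and [opposite_face] locates [p]. *)
Lemma star_front : star P Q `|v|.
Proof.
split.
- by move=> s s1; apply/tau_fun/sphereP.
- by move=> s t s1 t1; rewrite tau_iso; [exact: dist_line|exact: sphereP|exact: sphereP].
- move=> s t s1 t1; rewrite tau_iso; [|exact: sphereP|exact: sphereN].
  by rewrite opprK opposite_norm.
- move=> s w s1 Nw; have [|p Sp pw] := tau_surj (_ : unit_sphere Y (- w)).
    by rewrite /unit_sphere /= normrN.
  have -> : P s + w = tau (u + s *: v) - tau p by rewrite pw opprK.
  rewrite tau_iso //; last exact/sphereP/ltW.
  move=> /(opposite_face span seg s1 Sp)[t t1 pe]; exists t => //.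
  by rewrite /Q -pe pw opprK.
Qed.

Lemma star_back : star Q P `|v|.
Proof.
split.
- by move=> s s1; rewrite normrN; apply/tau_fun/sphereN.
- move=> s t s1 t1; rewrite /Q -opprD normrN tau_iso; [|exact: sphereN|exact: sphereN].
  by rewrite -opprD normrN dist_line.
- move=> s t s1 t1; rewrite /Q addrC tau_iso; [|exact: sphereP|exact: sphereN].
  by rewrite opprK opposite_norm.
- move=> s w s1 Nw; have [p Sp pw] := tau_surj (Nw : unit_sphere Y w).
  rewrite -pw /Q addrC tau_iso //; last exact/sphereN/ltW.
  rewrite opprK addrC -{1}[p]opprK => H.
  have Sp' : `|- p| = 1 by rewrite normrN.
  have [t t1 /oppr_inj pe] := opposite_face span seg s1 Sp' H.
  by exists t => //; rewrite pe.
Qed.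

End SphereIsometry.

(** * Linear extension of the sphere isometry *)

Lemma linear_extension (R : realType) (X Y : normedModType R) (u v : X) (a b : Y) :
  (forall z, exists x y, z = x *: u + y *: v) ->
  (forall t, `|u + t *: v| = 1 <-> `|t| <= 1) ->
  exists T : {linear X -> Y}, forall x y, T (x *: u + y *: v) = x *: a + y *: b.
Proof.
move=> span seg.
have /choice [f fE] : forall z, exists p : R * R, z = p.1 *: u + p.2 *: v.
  by move=> z; have [x [y ->]] := span z; exists (x, y).
pose T z := (f z).1 *: a + (f z).2 *: b.
have TE x y : T (x *: u + y *: v) = x *: a + y *: b.
  by rewrite /T; have [<- <-] := coordinates_unique seg (fE (x *: u + y *: v)).
have linT : linear T.
  move=> k p q; rewrite (fE p) (fE q) scalerDr addrACA !scalerA -!scalerDl !TE.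
  by rewrite scalerDr !scalerA addrACA -!scalerDl.
pose Tlin : {linear X -> Y} := HB.pack T (GRing.isLinear.Build R X Y _ T linT).
by exists Tlin.
Qed.

Theorem corollary3p8 (R : realType) (X : normedModType R) :
  has_dimension X 2 -> ~ strictly_convex X -> mazur_ulam_property X.
Proof.
move=> dimX /maximal_segment [u [v seg]] Y tau tau_fun tau_surj tau_iso.
have span := coordinates_exist dimX seg.
have v0 := direction_norm_gt0 seg.
have [a [b [eps [Pe Qe epsP segY]]]] := star_segment v0
  (star_front tau_fun tau_surj tau_iso span seg)
  (star_back tau_fun tau_surj tau_iso span seg).
have fN1 := face_norm_of_segment segY; have fN2 := face_norm_of_segment seg.
set N1 := (fun x y => `|x *: a + y *: b|) in fN1.
set N2 := (fun x y => `|x *: u + y *: v|) in fN2.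
have tau_inj p q : `|p| = 1 -> `|q| = 1 -> tau p = tau q -> p = q.
  move=> Sp Sq e; have := tau_iso p q Sp Sq; rewrite e subrr normr0.
  by move=> /esym/eqP; rewrite normr_eq0 subr_eq0 => /eqP.
(* [f] is the inverse of [tau] in coordinates; off the sphere of [N1] the condition is void and
   [(0, 0)] serves as witness. *)
have /choice [f fE] : forall p : R * R, exists q : R * R, N1 p.1 p.2 = 1 ->
    N2 q.1 q.2 = 1 /\ tau (q.1 *: u + q.2 *: v) = p.1 *: a + p.2 *: b.
  move=> p; have [Np|] := eqVneq (N1 p.1 p.2) 1; last first.
    by move=> /eqP Np; exists (0, 0).
  have [z Sz tz] := tau_surj _ (Np : unit_sphere Y (p.1 *: a + p.2 *: b)).
  have [x [y ze]] := span z; exists (x, y) => _ /=.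
  by rewrite -tz /N2 -ze; split.
pose sx x y := (f (x, y)).1; pose sy x y := (f (x, y)).2.
have sN x y : N1 x y = 1 -> N2 (sx x y) (sy x y) = 1 by move=> /(fE (x, y))[].
have sE x y : N1 x y = 1 ->
    tau (sx x y *: u + sy x y *: v) = x *: a + y *: b by move=> /(fE (x, y))[].
have sub (V : normedModType R) (p q : V) x y x' y' :
    (x - x') *: p + (y - y') *: q = (x *: p + y *: q) - (x' *: p + y' *: q).
  by rewrite !scalerBl opprD addrACA.
have sU x y x' y' : N1 x y = 1 -> N2 x' y' = 1 ->
    tau (x' *: u + y' *: v) = x *: a + y *: b -> sx x y = x' /\ sy x y = y'.
  move=> Np Nq e; apply: (coordinates_unique seg); apply: tau_inj => //.
    exact: sN.
  by rewrite sE.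
have epsn : `|eps| = 1 by case: epsP => ->; rewrite ?normrN1 ?normr1.
have eps2 : eps * eps = 1 by case: epsP => ->; ring.
have emb : face_embedding N1 N2 sx sy eps.
  split=> //.
  - move=> x y x' y' Np Nq; rewrite /N1 /N2 !sub -!sE //.
    by rewrite tau_iso //; exact: sN.
  - move=> t t1; apply: sU; rewrite ?fn_face1 // !scale1r; exact: Pe.
  - move=> t t1.
    (* [Qe] at [- (eps * t)] yields the preimage of [- a + t *: b], as [eps * eps = 1]. *)
    have t1' : `|- (eps * t)| <= 1 by rewrite normrN normrM epsn mul1r.
    apply: sU; rewrite ?fn_faceN1 //; first by rewrite normrM epsn mul1r.
    have := Qe _ t1'; rewrite mulrN mulrA eps2 mul1r !scaleNr opprD opprK !scale1r.
    by move=> /(congr1 -%R); rewrite opprK opprD opprK.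
have Neq1 x y : N1 x y = 1 -> N2 x y = 1 /\ tau (x *: u + y *: v) = x *: a + y *: b.
  move=> Np; have [e1 e2] := face_embedding_id fN1 fN2 emb Np.
  by have := sN _ _ Np; have := sE _ _ Np; rewrite e1 e2.
have Neq x y : N1 x y = N2 x y.
  have [N0|N0] := eqVneq (N1 x y) 0.
    have x0 : x = 0 by apply/eqP; rewrite -normr_le0 -N0 (fn_ge fN1).
    have [y0|y0] := eqVneq y 0; first by rewrite /N1 /N2 x0 y0 !scale0r !addr0 !normr0.
    by move: N0; rewrite x0 => N0; have := fn_0y_gt0 fN1 y0; rewrite N0 ltxx.
  have Np : 0 < N1 x y by rewrite lt_neqAle eq_sym N0 (fn_ge0 fN1).
  have c0 : 0 <= (N1 x y)^-1 by rewrite invr_ge0 ltW.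
  have [|+ _] := Neq1 ((N1 x y)^-1 * x) ((N1 x y)^-1 * y).
    by rewrite (fnZ fN1) ger0_norm // mulVf.
  rewrite (fnZ fN2) ger0_norm // => e.
  by rewrite -[LHS]mulr1 -e mulrA mulfV // mul1r.
have [T TE] := linear_extension a b span seg; exists T; split.
  move=> p q _ _; rewrite -linearB.
  by have [x [y ->]] := span (p - q); rewrite TE; exact: Neq.
move=> p; have [x [y ->]] := span p => Sp; rewrite TE.
by have [|_ ->] := Neq1 x y; first by rewrite Neq.
Qed.
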